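(* Let $\{\mathbb{S}_n\}_{n\geqslant0}$ be the monic orthogonal polynomial system associated with an $xy$-symmetric weight function $W$ on $\Omega\subset\mathbb{R}^2$, with three term relation coefficients $\Gamma_{n,k}$, and let $\{\widehat{\mathbb{P}}_n^{(i,j)}\}_{n\geqslant0}$, $i,j\in\{0,1\}$, be the four associated small monic orthogonal polynomial systems, i.e. those with $$\mathbb{S}_{2n}(x,y)=\mathbb{P}_n^{(0,0)}(x^2,y^2)+x\,y\,\mathbb{P}_{n-1}^{(1,1)}(x^2,y^2),\qquad \mathbb{S}_{2n+1}(x,y)=x\,\mathbb{P}_n^{(1,0)}(x^2,y^2)+y\,\mathbb{P}_n^{(0,1)}(x^2,y^2),$$ where $\mathbb{P}_n^{(i,j)}=(\mathrm{J}_n^{(i,j)})^\top\,\widehat{\mathbb{P}}_n^{(i,j)}$. Then, for $k=1,2$ (with $x_1=x$, $x_2=y$), \begin{align*} \widehat{\mathbb{P}}_n^{(0,0)}(x,y)&=\widehat{\mathbb{P}}_n^{(2-k,k-1)}(x,y)+\widehat{\Gamma}_{n,k}^{(0,0)}\,\widehat{\mathbb{P}}_{n-1}^{(2-k,k-1)}(x,y), & n\geqslant0,\\ x_k\,\widehat{\mathbb{P}}_{n-1}^{(1,1)}(x,y)&=\mathrm{L}_{n-1,k}\,\widehat{\mathbb{P}}_n^{(k-1,2-k)}(x,y)+\widehat{\Gamma}_{n,k}^{(0,1)}\,\widehat{\mathbb{P}}_{n-1}^{(k-1,2-k)}(x,y), & n\geqslant1,\\ \widehat{\mathbb{P}}_n^{(k-1,2-k)}(x,y)&=\widehat{\mathbb{P}}_n^{(1,1)}(x,y)+\widehat{\Gamma}_{n,k}^{(1,1)}\,\widehat{\mathbb{P}}_{n-1}^{(1,1)}(x,y),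 & n\geqslant0,\\ x_k\,\widehat{\mathbb{P}}_n^{(2-k,k-1)}(x,y)&=\mathrm{L}_{n,k}\,\widehat{\mathbb{P}}_{n+1}^{(0,0)}(x,y)+\widehat{\Gamma}_{n,k}^{(1,0)}\,\widehat{\mathbb{P}}_n^{(0,0)}(x,y), & n\geqslant0, \end{align*} where, for $k=1,2$, \begin{align*} \widehat{\Gamma}_{n,k}^{(0,0)}&=\mathrm{J}_n^{(0,0)}\,\Gamma_{2n,k}\,(\mathrm{J}_{n-1}^{(1,0)})^\top, & \widehat{\Gamma}_{n,k}^{(0,1)}&=\mathrm{J}_{n-1}^{(1,1)}\,\Gamma_{2n,k}\,(\mathrm{J}_{n-1}^{(0,1)})^\top,\\ \widehat{\Gamma}_{n,k}^{(1,1)}&=\mathrm{J}_n^{(0,1)}\,\Gamma_{2n+1,k}\,(\mathrm{J}_{n-1}^{(1,1)})^\top, & \widehat{\Gamma}_{n,k}^{(1,0)}&=\mathrm{J}_n^{(1,0)}\,\Gamma_{2n+1,k}\,(\mathrm{J}_n^{(0,0)})^\top, \end{align*} and terms containing an object with index $-1$ are zero.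
   Context: Weight function on $\Omega\subset\mathbb{R}^2$: a nonnegative function $W$ on $\Omega$ with positive integral and all moments finite (defined up to null sets). It is $xy$-symmetric if $(x,y)\in\Omega$ implies $(-x,y),(x,-y)\in\Omega$, and $W(-x,y)=W(x,y)=W(x,-y)$ on $\Omega$. The monic orthogonal polynomial system (MOPS) associated with $W$ on $\Omega$ is the unique sequence of column vectors $\mathbb{P}_n=[P_{n,0},\dots,P_{n,n}]^\top$, $n\geqslant0$, of real bivariate polynomials with $P_{n,j}(x,y)=x^{n-j}y^j+(\text{polynomial of total degree}\leqslant n-1)$ and $\int_\Omega\mathbb{P}_n\mathbb{P}_m^\top W\,dx\,dy=0$ for $n\ne m$ (for $n=m$ this matrix is symmetric positive-definite). $\mathrm{L}_{n,1}=[\,I_{n+1}\mid 0\,]$ and $\mathrm{L}_{n,2}=[\,0\mid I_{n+1}\,]$ are $(n+1)\times(n+2)$ matrices. $\mathrm{J}_n^{(i,j)}$, $i,j\in\{0,1\}$, is the $(n+1)\times(2n+1+i+j)$ matrix whose entry (rows and columns indexed from $0$) in position $(h,2h+j)$ is $1$ for $0\leqslant h\leqslant n$, all other entries being $0$. Since $W$ is $xy$-symmetric, its MOPS satisfies $x_k\mathbb{S}_n=\mathrm{L}_{n,k}\mathbb{S}_{n+1}+\Gamma_{n,k}\mathbb{S}_{n-1}$ for $n\geqslant0$, $k=1,2$, with $\mathbb{S}_{-1}=0$ and, for $n\geqslant1$, $\Gamma_{n,k}=\mathbf{S}_n\mathrm{L}_{n-1,k}^\top\mathbf{S}_{n-1}^{-1}$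 of size $(n+1)\times n$, where $\mathbf{S}_n=\int_\Omega\mathbb{S}_n\mathbb{S}_n^\top W\,dx\,dy$. Small systems: each entry $S_{n,k}$ of $\mathbb{S}_n$ contains only powers of $x$ of the parity of $n-k$ and only powers of $y$ of the parity of $k$, so the displayed decomposition determines $\mathbb{P}_n^{(i,j)}$ and $\widehat{\mathbb{P}}_n^{(i,j)}=\mathrm{J}_n^{(i,j)}\mathbb{P}_n^{(i,j)}$: explicitly, for $0\leqslant h\leqslant n$, the $h$-th entry (from $0$) of $\widehat{\mathbb{P}}_n^{(0,0)}(x^2,y^2)$ is $S_{2n,2h}(x,y)$, of $xy\,\widehat{\mathbb{P}}_n^{(1,1)}(x^2,y^2)$ is $S_{2n+2,2h+1}(x,y)$, of $x\,\widehat{\mathbb{P}}_n^{(1,0)}(x^2,y^2)$ is $S_{2n+1,2h}(x,y)$, and of $y\,\widehat{\mathbb{P}}_n^{(0,1)}(x^2,y^2)$ is $S_{2n+1,2h+1}(x,y)$. $\{\widehat{\mathbb{P}}_n^{(i,j)}\}$ is the MOPS for $W^{(i,j)}(x,y)=\frac14x^iy^j\frac{1}{\sqrt{xy}}W(\sqrt x,\sqrt y)$ on $\{(x,y):x,y\geqslant0,(\sqrt x,\sqrt y)\in\Omega\}$. Vectors with index $-1$ are zero.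
   Formalization: For k=2 the printed Γ̂ formulas are false (they vanish by parity); the J superscripts (1,0) in Γ̂^(0,0) and Γ̂^(1,0) are replaced by (2-k,k-1), and (0,1) in Γ̂^(0,1) and Γ̂^(1,1) by (k-1,2-k); k=1 is unchanged. *)

(* Defs.v *)
From HB Require Import structures.
From mathcomp Require Import all_boot all_order all_algebra.
(* The notations of multinomials clash with those of analysis. *)
From mathcomp Require Import -(notations) mpoly.
From mathcomp Require Import all_classical all_reals all_analysis.

Set Implicit Arguments.
Unset Strict Implicit.
Unset Printing Implicit Defensive.

Import Order.TTheory GRing.Theory Num.Theory.
Local Open Scope classical_set_scope.
Local Open Scope ring_scope.

Notation plane R := (measurableTypeR R * measurableTypeR R)%type.
Notation leb2 R := (@lebesgue_measure R \x @lebesgue_measure R)%E.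
Notation bipoly R := (mpoly 2 R).

(** Weights.  A weight is only meaningful up to null sets, so pointwise
    conditions on it are required almost everywhere. *)

Record weight_function (R : realType) (Om : set (plane R)) (W : plane R -> R)
    : Prop := WeightFunction {
  weight_dom : measurable Om;
  weight_meas : measurable_fun Om W;
  weight_ge0 : {ae leb2 R, forall z, Om z -> 0 <= W z};
  weight_gt0 : (0 < \int[leb2 R]_(z in Om) (W z)%:E)%E;
  weight_moments : forall i j : nat,
    (leb2 R).-integrable Om (fun z => (z.1 ^+ i * z.2 ^+ j * W z)%:E) }.

Definition xy_symmetric (R : realType) (Om : set (plane R)) (W : plane R -> R)
    : Prop :=
  (forall x y : R, Om (x, y) -> Om (- x, y) /\ Om (x, - y)) /\
  {ae leb2 R, forall z, Om z ->
     W (- z.1, z.2) = W z /\ W (z.1, - z.2) = W z}.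

(** Bivariate polynomials. *)

Definition Xx (R : realType) : bipoly R := mpolyX R (mnm1 (0 : 'I_2)).
Definition Xy (R : realType) : bipoly R := mpolyX R (mnm1 (1 : 'I_2)).

(* x_1 = x and x_2 = y; only k = 1, 2 are meaningful. *)
Definition xvar (R : realType) (k : nat) : bipoly R :=
  if k == 1%N then Xx R else Xy R.

Definition eval2 (R : realType) (p : bipoly R) (z : plane R) : R :=
  meval (fun i : 'I_2 => if i == 0 then z.1 else z.2) p.

(* p(x, y) |-> p(x^2, y^2), entrywise *)
Definition atsq (R : realType) (n : nat) (v : 'cV[bipoly R]_n) :
    'cV[bipoly R]_n :=
  map_mx (comp_mpoly [tuple Xx R ^+ 2; Xy R ^+ 2]) v.

Definition scalmx (R : realType) (m n : nat) (A : 'M[R]_(m, n))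
    (v : 'cV[bipoly R]_n) : 'cV[bipoly R]_m :=
  map_mx (@mpolyC 2 R) A *m v.
Notation "A *pm v" := (scalmx A v) (at level 40, left associativity)
  : ring_scope.

(** Systems of column vectors, the n-th one having n + 1 entries. *)

Definition polysys (R : realType) := forall n : nat, 'cV[bipoly R]_n.+1.

(* [pred_vec V n] is V_(n-1), of size n, with V_(-1) the empty vector. *)
Definition pred_vec (R : realType) (V : polysys R) (n : nat) : 'cV[bipoly R]_n :=
  if n is m.+1 then V m else 0.

Definition intW (R : realType) (Om : set (plane R)) (W : plane R -> R)
    (p : bipoly R) : R :=
  \int[leb2 R]_(z in Om) (eval2 p z * W z).

(* The matrix of the integrals of the entries of u v^T W. *)
Definition gram (R : realType) (Om : set (plane R)) (W : plane R -> R)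
    (m n : nat) (u : 'cV[bipoly R]_m) (v : 'cV[bipoly R]_n) : 'M[R]_(m, n) :=
  map_mx (intW Om W) (u *m v^T).

(* [msize p] is 1 + the total degree of p, and 0 for p = 0. *)
Definition is_mops (R : realType) (Om : set (plane R)) (W : plane R -> R)
    (SS : polysys R) : Prop :=
  (forall (n : nat) (j : 'I_n.+1),
     (msize (SS n j 0 - Xx R ^+ (n - j) * Xy R ^+ j)%R <= n)%N) /\
  (forall n m : nat, n <> m -> gram Om W (SS n) (SS m) = 0).

(** Structure matrices.  They are indexed by their dimensions rather than by n,
    so that index -1 needs no special treatment. *)

(* L_{n,k} = [Lmx R k n.+1], for k = 1, 2 *)
Definition Lmx (R : realType) (k r : nat) : 'M[R]_(r, r.+1) :=
  \matrix_(h < r, l < r.+1) (l == h + (k - 1) :> nat)%N%:R.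

(* J_n^{(i,j)} = [Jmx R j n.+1 (2n+1+i+j)]: the index i only enters through the
   number of columns c, which is 2r-1+i+j when there are r rows. *)
Definition Jmx (R : realType) (j r c : nat) : 'M[R]_(r, c) :=
  \matrix_(h < r, l < c) (l == h.*2 + j :> nat)%N%:R.

(* Gamma_{n,k} = S_n L_{n-1,k}^T S_{n-1}^{-1}, of size (n+1) x n, where S_n is
   the Gram matrix of the n-th vector; empty for n = 0. *)
Definition Gam (R : realType) (Om : set (plane R)) (W : plane R -> R)
    (SS : polysys R) (n k : nat) : 'M[R]_(n.+1, n) :=
  gram Om W (SS n) (SS n) *m (Lmx R k n)^T
    *m invmx (gram Om W (pred_vec SS n) (pred_vec SS n)).

(** The matrices \hat\Gamma_{n,k}^{(i,j)}.  In the superscripts of the J's,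
    (2-k,k-1) is (1,0) for k = 1 and (0,1) for k = 2, and (k-1,2-k) is the
    other one of these two.  Multiplication by y instead of x exchanges the
    parity classes (1,0) and (0,1), so these indices have to depend on k. *)

(* J_n^{(0,0)} Gamma_{2n,k} (J_{n-1}^{(2-k,k-1)})^T *)
Definition hGam00 (R : realType) (Om : set (plane R)) (W : plane R -> R)
    (SS : polysys R) (n k : nat) : 'M[R]_(n.+1, n) :=
  Jmx R 0 n.+1 n.*2.+1 *m Gam Om W SS n.*2 k *m (Jmx R (k - 1) n n.*2)^T.

(* J_{n-1}^{(1,1)} Gamma_{2n,k} (J_{n-1}^{(k-1,2-k)})^T *)
Definition hGam01 (R : realType) (Om : set (plane R)) (W : plane R -> R)
    (SS : polysys R) (n k : nat) : 'M[R]_(n, n) :=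
  Jmx R 1 n n.*2.+1 *m Gam Om W SS n.*2 k *m (Jmx R (2 - k) n n.*2)^T.

(* J_n^{(k-1,2-k)} Gamma_{2n+1,k} (J_{n-1}^{(1,1)})^T *)
Definition hGam11 (R : realType) (Om : set (plane R)) (W : plane R -> R)
    (SS : polysys R) (n k : nat) : 'M[R]_(n.+1, n) :=
  Jmx R (2 - k) n.+1 n.*2.+2 *m Gam Om W SS n.*2.+1 k
    *m (Jmx R 1 n n.*2.+1)^T.

(* J_n^{(2-k,k-1)} Gamma_{2n+1,k} (J_n^{(0,0)})^T *)
Definition hGam10 (R : realType) (Om : set (plane R)) (W : plane R -> R)
    (SS : polysys R) (n k : nat) : 'M[R]_(n.+1, n.+1) :=
  Jmx R (k - 1) n.+1 n.*2.+2 *m Gam Om W SS n.*2.+1 k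
    *m (Jmx R 0 n.+1 n.*2.+1)^T.

(** [Ph i j n] is the vector \hat P_n^{(i,j)}, for i, j in {0, 1}; the vectors
    P_n^{(i,j)} are the (J_n^{(i,j)})^T \hat P_n^{(i,j)}. *)
Definition small_systems (R : realType) (SS : polysys R)
    (Ph : nat -> nat -> polysys R) : Prop :=
  forall n : nat,
    SS n.*2 = atsq ((Jmx R 0 n.+1 n.*2.+1)^T *pm Ph 0%N 0%N n)
      + (Xx R * Xy R) *: atsq ((Jmx R 1 n n.*2.+1)^T *pm pred_vec (Ph 1%N 1%N) n) /\
    SS n.*2.+1 = Xx R *: atsq ((Jmx R 0 n.+1 n.*2.+2)^T *pm Ph 1%N 0%N n)
      + Xy R *: atsq ((Jmx R 1 n.+1 n.*2.+2)^T *pm Ph 0%N 1%N n).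

(* Main.v *)
(** The form [p, q |-> \int p q W] is definite on polynomials, because the zero
    set of a nonzero polynomial is Lebesgue null (Fubini). The decomposition into
    small systems forces every monomial of [S_n] to have total degree of the
    parity of [n]; hence [x_k S_n - L_{n,k} S_{n+1}], a priori of degree at most
    [n], has degree at most [n - 1], and orthogonality turns this into the three
    term relation without a middle term. Multiplying that relation on the left by
    a matrix [J] selects the rows of one parity class; comparing the monomials
    [x^a y^b] of the matching parities of [a] and [b] then leaves exactly one of
    the four announced relations. *)

Require Import Defs.
From HB Require Import structures.
From mathcomp Require Import all_boot all_order all_algebra.
From mathcomp Require Import -(notations) mpoly.
From mathcomp Require Import all_classical all_reals all_analysis.
From mathcomp Require Import measurable_realfun zify.

Set Implicit Arguments.
Unset Strict Implicit.
Unset Printing Implicit Defensive.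

Import Order.TTheory GRing.Theory Num.Theory.
Local Open Scope classical_set_scope.
Local Open Scope ring_scope.

(** * Monomials *)

Lemma lift01 : lift ord0 ord0 = 1 :> 'I_2.
Proof. exact/val_inj. Qed.

Definition mon (a b : nat) : multinom 2 := Multinom [tuple a; b].

Lemma mon0 (a b : nat) : mon a b (0 : 'I_2) = a. Proof. by []. Qed.

Lemma mon1 (a b : nat) : mon a b (1 : 'I_2) = b. Proof. by []. Qed.

Lemma mon2P (m1 m2 : multinom 2) :
  m1 (0 : 'I_2) = m2 (0 : 'I_2) -> m1 (1 : 'I_2) = m2 (1 : 'I_2) -> m1 = m2.
Proof.
move=> e0 e1; apply/mnmP => -[[|[|//]] lt].
  by rewrite (_ : Ordinal lt = 0) //; exact/val_inj.
by rewrite (_ : Ordinal lt = 1) //; exact/val_inj.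
Qed.

Lemma mon_eta (m : multinom 2) : mon (m (0 : 'I_2)) (m (1 : 'I_2)) = m.
Proof. exact: mon2P. Qed.

Lemma mon_inj (a b a' b' : nat) : (mon a b == mon a' b') = (a == a') && (b == b').
Proof.
apply/eqP/andP => [e|[/eqP -> /eqP ->]//].
by rewrite -(mon0 a b) -{2}(mon1 a b) e mon0 mon1.
Qed.

Lemma monD (a b a' b' : nat) :
  mnm_add (mon a b) (mon a' b') = mon (a + a') (b + b').
Proof. by apply: mon2P; rewrite mnmDE. Qed.

Lemma mdeg_mon (a b : nat) : mdeg (mon a b) = (a + b)%N.
Proof.
by rewrite mdegE big_ord_recl big_ord1 /= lift01.
Qed.

(** * The moment functional *)

Lemma eval2E (R : realType) (p : bipoly R) (z : plane R) :
  eval2 p z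
  = \sum_(m <- msupp p) mcoeff m p * (z.1 ^+ m (0 : 'I_2) * z.2 ^+ m (1 : 'I_2)).
Proof.
rewrite /eval2 mevalE; apply: eq_bigr => m _.
by rewrite big_ord_recl big_ord1 /= lift01.
Qed.

Lemma eval2D (R : realType) (p q : bipoly R) (z : plane R) :
  eval2 (p + q) z = eval2 p z + eval2 q z.
Proof. exact: mevalD. Qed.

Lemma eval2Z (R : realType) (c : R) (p : bipoly R) (z : plane R) :
  eval2 (c *: p) z = c * eval2 p z.
Proof. exact: mevalZ. Qed.

Lemma eval2M (R : realType) (p q : bipoly R) (z : plane R) :
  eval2 (p * q) z = eval2 p z * eval2 q z.
Proof. exact: mevalM. Qed.

Lemma measurable_eval2 (R : realType) (p : bipoly R) :
  measurable_fun setT (eval2 p).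
Proof.
rewrite (funext (eval2E p)).
apply: measurable_sum => m.
apply: measurable_funM; first exact: measurable_cst.
apply: measurable_funM; apply: measurable_funX.
  exact: measurable_fst.
exact: measurable_snd.
Qed.

Lemma measurable_eval2_zeros (R : realType) (p : bipoly R) :
  measurable [set z | eval2 p z = 0].
Proof.
by have := measurable_eval2 p measurableT (measurable_set1 0); rewrite setTI.
Qed.

(** A polynomial is a finite combination of monomials, and each moment of a weight is finite. *)
Lemma integrable_eval2 (R : realType) (Om : set (plane R)) (W : plane R -> R)
    (hW : weight_function Om W) (p : bipoly R) :
  (leb2 R).-integrable Om (EFin \o (fun z => eval2 p z * W z)).
Proof.
have mOm := weight_dom hW.
pose h (m : multinom 2) (z : plane R) :=
  ((mcoeff m p)%:E * (z.1 ^+ m (0 : 'I_2) * z.2 ^+ m (1 : 'I_2) * W z)%:E)%E.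
apply: (@eq_integrable _ _ _ _ _ mOm (fun z => \sum_(m <- msupp p) h m z)%E).
  move=> z _ /=; rewrite /h eval2E mulr_suml -sumEFin; apply: eq_bigr => m _.
  by rewrite -EFinM mulrA.
apply: integrable_sum => // m _; apply: integrableZl => //.
exact: weight_moments hW _ _.
Qed.

Lemma intWD (R : realType) (Om : set (plane R)) (W : plane R -> R)
    (hW : weight_function Om W) (p q : bipoly R) :
  intW Om W (p + q) = intW Om W p + intW Om W q.
Proof.
rewrite /intW -RintegralD; [|exact: weight_dom hW|exact: integrable_eval2..].
by apply: eq_Rintegral => z _; rewrite eval2D mulrDl.
Qed.

Lemma intWZ (R : realType) (Om : set (plane R)) (W : plane R -> R)
    (hW : weight_function Om W) (c : R) (p : bipoly R) :
  intW Om W (c *: p) = c * intW Om W p.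
Proof.
rewrite /intW -RintegralZl; [|exact: weight_dom hW|exact: integrable_eval2].
by apply: eq_Rintegral => z _; rewrite eval2Z mulrA.
Qed.

(** * Null zero sets and definiteness of the moment form *)

Lemma roots_finite (F : fieldType) (p : {poly F}) :
  p != 0 -> finite_set [set y | root p y].
Proof.
have [n] := ubnP (size p); elim: n p => // n IH p ltpn p0.
have [[a ra]|nr] := pselect (exists a, root p a); last first.
  rewrite (_ : [set _ | _] = set0)//; apply/seteqP; split => // y ry.
  by apply: nr; exists y.
have /factor_theorem[q pq] := ra.
have q0 : q != 0 by apply: contra_neq p0 => q0; rewrite pq q0 mul0r.
apply: (@sub_finite_set _ _ ([set a] `|` [set y | root q y])).
  move=> y /=; rewrite pq rootM root_XsubC => /orP[ry|/eqP ->]; [by right|by left].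
rewrite finite_setU; split; first exact: finite_set1.
apply: IH => //; move: ltpn; rewrite pq size_Mmonic ?monicXsubC// size_XsubC.
by rewrite addn2.
Qed.

Lemma lebesgue_measure_roots (R : realType) (p : {poly R}) :
  p != 0 -> @lebesgue_measure R [set y | root p y] = 0%E.
Proof.
by move=> p0; apply/countable_lebesgue_measure0/finite_set_countable/roots_finite.
Qed.

(** Iterated univariate form with y as outer variable and coefficients in x, which gives access to
    the leading coefficient in y. *)
Definition poly_of_bipoly (R : realType) (p : bipoly R) : {poly {poly R}} :=
  \sum_(m <- msupp p)
     (mcoeff m p *: 'X^(m (0 : 'I_2)))%:P * 'X^(m (1 : 'I_2)).

Lemma horner_poly_of_bipoly (R : realType) (p : bipoly R) (z : plane R) :
  (poly_of_bipoly p).[z.2%:P].[z.1] = eval2 p z.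
Proof.
rewrite eval2E !horner_sum; apply: eq_bigr => m _.
by rewrite hornerM hornerC hornerXn hornerM hornerZ hornerXn -polyC_exp hornerC -mulrA.
Qed.

Lemma poly_of_bipoly_eq0 (R : realType) (p : bipoly R) :
  (poly_of_bipoly p == 0) = (p == 0).
Proof.
apply/eqP/eqP => [p0|->]; last by rewrite /poly_of_bipoly msupp0 big_nil.
apply/mpolyP => m; rewrite mcoeff0.
have /(congr1 (fun q : {poly {poly R}} => q`_(m (1 : 'I_2))`_(m (0 : 'I_2)))) := p0.
rewrite coef0 coef0 /poly_of_bipoly coef_sum coef_sum.
have [mp|/memN_msupp_eq0//] := boolP (m \in msupp p).
rewrite (bigD1_seq m) ?msupp_uniq//= big1 ?addr0.
  by rewrite coefCM coefXn eqxx mulr1 coefZ coefXn eqxx mulr1.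
move=> m' ne; rewrite coefCM coefXn.
have [e1|] := eqVneq; last by rewrite mulr0 coef0.
rewrite mulr1 coefZ coefXn; have [e0|] := eqVneq; last by rewrite mulr0.
by case/eqP: ne; exact: mon2P.
Qed.

(** Fubini by vertical slices: unless x is one of the finitely many roots of the leading coefficient
    in y, the slice at x is the root set of a nonzero univariate polynomial, hence finite and
    null. *)
Lemma eval2_zeros_null (R : realType) (p : bipoly R) :
  p != 0 -> leb2 R [set z | eval2 p z = 0] = 0%E.
Proof.
rewrite -poly_of_bipoly_eq0; set q := poly_of_bipoly p => q0.
set A := [set z | _].
have mA : measurable A by exact: measurable_eval2_zeros.
pose B := [set x | root (lead_coef q) x].
have B0 : @lebesgue_measure R B = 0%E.
  by apply: lebesgue_measure_roots; rewrite lead_coef_eq0.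
have mB : (measurable : set (set (measurableTypeR R))) B.
  apply: countable_measurable; first by move=> t; exact: measurable_set1.
  by apply/finite_set_countable/roots_finite; rewrite lead_coef_eq0.
rewrite /product_measure1.
rewrite (ge0_negligible_integral mB)//; last exact: measurable_fun_xsection.
apply: integral0_eq => x [_ nBx] /=.
rewrite (_ : xsection A x = [set y | root (map_poly (horner_eval x) q) y]).
  apply: lebesgue_measure_roots; apply/negP => /eqP mq0; apply: nBx.
  (* The coefficient of index [(size q).-1] specialises to the value of [lead_coef q] at x, so a
     vanishing slice polynomial would put x in [B]. *)
  have := congr1 (fun r : {poly R} => r`_(size q).-1) mq0.
  by rewrite coef_map coef0 /= => lc0; apply/rootP.
have rootE y : root (map_poly (horner_eval x) q) y = (eval2 p (x, y) == 0).
  rewrite -(horner_poly_of_bipoly p (x, y)) /root /=.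
  by rewrite -[X in _.[X] == 0](hornerC y x) -/(horner_eval x y%:P) horner_map.
apply/seteqP; split=> y /=; rewrite rootE.
  by move/xsectionP => /= /eqP.
by move/eqP => ?; apply/xsectionP.
Qed.

(** A zero integral forces p^2 W = 0 almost everywhere on [Om]. A nonzero p vanishes only on a null
    set, so W would be zero almost everywhere on [Om], against its positive integral. *)
Lemma intW_sqr_eq0 (R : realType) (Om : set (plane R)) (W : plane R -> R)
    (hW : weight_function Om W) (p : bipoly R) :
  intW Om W (p * p) = 0 -> p = 0.
Proof.
have mOm := weight_dom hW; have mW := weight_meas hW.
move=> Ip0; apply/eqP; apply: contraT => p0.
have := weight_gt0 hW; suff -> : (\int[leb2 R]_(z in Om) (W z)%:E = 0)%E by rewrite ltxx.
have intp := integrable_eval2 hW (p * p).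
have mp : measurable_fun Om (EFin \o (fun z => eval2 (p * p) z * W z)).
  by case/integrableP: intp.
have abs0 : (\int[leb2 R]_(z in Om) `|(eval2 (p * p) z * W z)%:E| = 0)%E.
  rewrite -[RHS](_ : (intW Om W (p * p))%:E = _); last by rewrite Ip0.
  rewrite /intW /Rintegral fineK; last exact: integrable_fin_num.
  apply: ae_eq_integral => //; first exact: measurableT_comp.
  apply: filterS (weight_ge0 hW) => z Wz Omz.
  by rewrite gee0_abs// lee_fin mulr_ge0// ?Wz// eval2M -expr2 sqr_ge0.
have [/(_ abs0) ae0 _] := @ae_eq_integral_abs _ _ _ (leb2 R) _ mOm _ mp.
transitivity (\int[leb2 R]_(z in Om) (cst 0 z))%E; last by rewrite integral0.
apply: ae_eq_integral => //; first exact/measurable_EFinP.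
have pnz : {ae leb2 R, forall z, eval2 p z <> 0}.
  exists [set z | eval2 p z = 0]; split.
  - exact: measurable_eval2_zeros.
  - exact: eval2_zeros_null.
  - by move=> z /= /contrapT.
apply: filterS2 pnz ae0 => z /eqP pz0 + Omz => /(_ Omz) /= [] /eqP.
by rewrite eval2M !mulf_eq0 (negbTE pz0) /= => /eqP ->.
Qed.

(** * Parity classes of monomials *)

Lemma XxXyE (R : realType) (a b : nat) : Xx R ^+ a * Xy R ^+ b = mpolyX R (mon a b).
Proof.
rewrite /Xx /Xy !mpolyXn -mpolyXD; congr (mpolyX R _).
by apply: mon2P; rewrite mnmDE !mulmnE !mnm1E ?mon0 ?mon1 /= ?mul1n ?mul0n ?addn0.
Qed.

Local Notation sqvars R := [tuple Xx R ^+ 2; Xy R ^+ 2].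

Lemma comp_mpoly_mon (R : realType) (a b : nat) :
  comp_mpoly (sqvars R) (mpolyX R (mon a b)) = mpolyX R (mon a.*2 b.*2).
Proof.
rewrite comp_mpolyX big_ord_recl big_ord1 /=.
by rewrite lift01 -XxXyE -!mul2n !exprM.
Qed.

(** The substitution produces only even exponents, so the factor x^i y^j puts every monomial into
    the parity class (i, j), and halving exponents recovers the coefficients of p. *)
Lemma mcoeff_sq (R : realType) (i j : bool) (p : bipoly R) (m : multinom 2) :
  mcoeff m (Xx R ^+ i * Xy R ^+ j * comp_mpoly (sqvars R) p) =
  if (odd (m (0 : 'I_2)) == i) && (odd (m (1 : 'I_2)) == j)
  then mcoeff (mon (m (0 : 'I_2))./2 (m (1 : 'I_2))./2) p else 0.
Proof.
rewrite -[m in LHS]mon_eta; set a := m (0 : 'I_2); set b := m (1 : 'I_2).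
rewrite [p in LHS]mpolyE [p in RHS]mpolyE !raddf_sum /= mulr_sumr raddf_sum /=.
transitivity (\sum_(m' <- msupp p)
   if (odd a == i) && (odd b == j)
   then mcoeff (mon a./2 b./2) (mcoeff m' p *: mpolyX R m') else 0).
  apply: eq_bigr => m' _.
  rewrite -{2}(mon_eta m') comp_mpolyZ comp_mpoly_mon -scalerAr mcoeffZ.
  rewrite XxXyE -mpolyXD mcoeffX mcoeffZ mcoeffX; set c := mcoeff m' p.
  rewrite -[m' in RHS]mon_eta.
  rewrite monD.
  rewrite !mon_inj.
  set u := m' _; set v := m' _.
  have -> : (i + u.*2 == a)%N = (odd a == i) && (u == a./2).
    by rewrite eq_sym -{1}(odd_double_half a); case: (odd a); case: i; lia.
  have -> : (j + v.*2 == b)%N = (odd b == j) && (v == b./2).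
    by rewrite eq_sym -{1}(odd_double_half b); case: (odd b); case: j; lia.
  by case: (odd a == i); case: (odd b == j); rewrite /= ?andbF ?mulr0.
by case: ifP => _ //; rewrite big1.
Qed.

Lemma msizeP (R : realType) (p : bipoly R) (n : nat) :
  (msize p <= n)%N <-> (forall m : multinom 2, (n <= mdeg m)%N -> mcoeff m p = 0).
Proof.
split=> [le m lem|h].
  by apply/memN_msupp_eq0/msize_mdeg_ge/(leq_trans le).
rewrite msizeE; apply/bigmax_leqP_seq => m mp _; rewrite ltnNge.
by apply: contraTN mp => /h /eqP; rewrite mcoeff_eq0.
Qed.

Definition shiftx (k : nat) : multinom 2 := if k == 1%N then mon 1 0 else mon 0 1.

Lemma xvarE (R : realType) (k : nat) : xvar R k = mpolyX R (shiftx k).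
Proof.
rewrite /xvar /shiftx; case: eqP => _; rewrite -XxXyE ?expr0 ?expr1 ?mulr1 ?mul1r//.
Qed.

Lemma msize_xvarM (R : realType) (k n : nat) (p : bipoly R) :
  (msize p <= n)%N -> (msize (xvar R k * p)%R <= n.+1)%N.
Proof.
have [-> _|p0 le] := eqVneq p 0; first by rewrite mulr0 msize0.
have s1 : mdeg (shiftx k) = 1%N by rewrite /shiftx; case: ifP => _; rewrite mdeg_mon.
rewrite xvarE msizeM// ?msizeX ?s1//.
by rewrite -msize_poly_eq0 msizeX.
Qed.

(** The leading monomial of index j in degree n goes to the one of index j + k - 1 in degree n + 1,
    the column where row j of L_{n,k} has its 1. *)
Lemma xvar_mon (R : realType) (k n j : nat) : k = 1%N \/ k = 2%N -> (j <= n)%N ->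
  xvar R k * mpolyX R (mon (n - j) j)
  = mpolyX R (mon (n.+1 - (j + (k - 1))) (j + (k - 1))).
Proof.
move=> hk le; rewrite xvarE -mpolyXD /shiftx.
by case: hk => ->; rewrite monD; congr (mpolyX R (mon _ _)); lia.
Qed.

(** A factor x_k flips the parity of the total degree. *)
Lemma mcoeff_xvarM_eq0 (R : realType) (k : nat) (p : bipoly R) (b : bool)
    (m : multinom 2) :
  (forall m, odd (mdeg m) != b -> mcoeff m p = 0) ->
  odd (mdeg m) = b -> mcoeff m (xvar R k * p) = 0.
Proof.
move=> h om; rewrite [p]mpolyE mulr_sumr raddf_sum /= big1// => m' _.
rewrite -scalerAr mcoeffZ xvarE -mpolyXD mcoeffX.
have s1 : mdeg (shiftx k) = 1%N by rewrite /shiftx; case: ifP => _; rewrite mdeg_mon.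
case: eqP => e; last by rewrite mulr0.
by rewrite h ?mul0r// -om -e mdegD s1 /=; case: odd.
Qed.

Lemma odd_mdeg (m : multinom 2) :
  odd (mdeg m) = odd (m (0 : 'I_2)) (+) odd (m (1 : 'I_2)).
Proof. by rewrite -[in LHS](mon_eta m) mdeg_mon oddD. Qed.

(** * Three term relation *)

Lemma scalmxA (R : realType) (m n p : nat) (A : 'M[R]_(m, n)) (B : 'M[R]_(n, p))
    (v : 'cV[bipoly R]_p) : A *pm (B *pm v) = (A *m B) *pm v.
Proof. by rewrite /scalmx map_mxM mulmxA. Qed.

Lemma scal1mx (R : realType) (n : nat) (v : 'cV[bipoly R]_n) : 1%:M *pm v = v.
Proof. by rewrite /scalmx map_mx1 mul1mx. Qed.

Lemma scal0mx (R : realType) (m n : nat) (v : 'cV[bipoly R]_n) :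
  (0 : 'M[R]_(m, n)) *pm v = 0.
Proof. by rewrite /scalmx map_mx0 mul0mx. Qed.

Lemma scalmxDr (R : realType) (m n : nat) (A : 'M[R]_(m, n)) (u v : 'cV[bipoly R]_n) :
  A *pm (u + v) = A *pm u + A *pm v.
Proof. exact: mulmxDr. Qed.

Lemma scalmxZr (R : realType) (m n : nat) (A : 'M[R]_(m, n)) (c : bipoly R)
    (v : 'cV[bipoly R]_n) : A *pm (c *: v) = c *: (A *pm v).
Proof. by rewrite /scalmx scalemxAr. Qed.

Lemma scalmxE (R : realType) (m n : nat) (A : 'M[R]_(m, n)) (v : 'cV[bipoly R]_n)
    (i : 'I_m) (j : 'I_1) : (A *pm v) i j = \sum_l A i l *: v l j.
Proof. by rewrite mxE; apply: eq_bigr => l _; rewrite mxE mul_mpolyC. Qed.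

Lemma scalmx_atsq (R : realType) (m n : nat) (A : 'M[R]_(m, n)) (v : 'cV[bipoly R]_n) :
  A *pm atsq v = atsq (A *pm v).
Proof.
rewrite /atsq /scalmx map_mxM; congr (_ *m _).
by apply/matrixP => i j; rewrite !mxE /= comp_mpolyC.
Qed.

Lemma Lmx_scalE (R : realType) (k n : nat) (v : 'cV[bipoly R]_n.+1)
    (i : 'I_n) (i' : 'I_n.+1) :
  i' = (i + (k - 1))%N :> nat -> (Lmx R k n *pm v) i 0 = v i' 0.
Proof.
move=> e; rewrite scalmxE (bigD1 i') //= mxE e eqxx scale1r big1 ?addr0//.
by move=> l; rewrite mxE -e -val_eqE => /negbTE ->; rewrite scale0r.
Qed.

Section Moments.
Variables (R : realType) (Om : set (plane R)) (W : plane R -> R).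
Hypothesis hW : weight_function Om W.

Lemma intW0 : intW Om W 0 = 0.
Proof. by rewrite -(scale0r (0 : bipoly R)) intWZ// mul0r. Qed.

Lemma intW_sum (I : Type) (s : seq I) (F : I -> bipoly R) :
  intW Om W (\sum_(i <- s) F i) = \sum_(i <- s) intW Om W (F i).
Proof. by apply: big_morph; [exact: intWD|exact: intW0]. Qed.

Lemma gramE (m n : nat) (u : 'cV[bipoly R]_m) (v : 'cV[bipoly R]_n) i j :
  gram Om W u v i j = intW Om W (u i 0 * v j 0).
Proof. by rewrite !mxE big_ord1 mxE. Qed.

Lemma gram_tr (m n : nat) (u : 'cV[bipoly R]_m) (v : 'cV[bipoly R]_n) :
  (gram Om W u v)^T = gram Om W v u.
Proof. by apply/matrixP => i j; rewrite mxE !gramE mulrC. Qed.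

Lemma gramDl (m n : nat) (u u' : 'cV[bipoly R]_m) (v : 'cV[bipoly R]_n) :
  gram Om W (u + u') v = gram Om W u v + gram Om W u' v.
Proof. apply/matrixP => i j; rewrite /gram mulmxDl [LHS]mxE [X in intW _ _ X]mxE intWD//.
by rewrite [RHS]mxE [X in _ = X + _]mxE [X in _ = _ + X]mxE.
Qed.

Lemma gram_scalmxl (p m n : nat) (A : 'M[R]_(p, m)) (u : 'cV[bipoly R]_m)
    (v : 'cV[bipoly R]_n) : gram Om W (A *pm u) v = A *m gram Om W u v.
Proof.
apply/matrixP => i j; rewrite gramE scalmxE mxE mulr_suml intW_sum.
by apply: eq_bigr => l _; rewrite gramE -scalerAl intWZ.
Qed.

Lemma gramNl (m n : nat) (u : 'cV[bipoly R]_m) (v : 'cV[bipoly R]_n) :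
  gram Om W (- u) v = - gram Om W u v.
Proof.
apply/matrixP => i j; rewrite /gram mulNmx [LHS]mxE [X in intW _ _ X]mxE.
by rewrite -scaleN1r intWZ// mulN1r [RHS]mxE [in RHS]mxE.
Qed.

Lemma gramBl (m n : nat) (u u' : 'cV[bipoly R]_m) (v : 'cV[bipoly R]_n) :
  gram Om W (u - u') v = gram Om W u v - gram Om W u' v.
Proof. by rewrite gramDl gramNl. Qed.

Lemma gramDr (m n : nat) (u : 'cV[bipoly R]_m) (v v' : 'cV[bipoly R]_n) :
  gram Om W u (v + v') = gram Om W u v + gram Om W u v'.
Proof.
apply/matrixP => i j; rewrite /gram linearD /= mulmxDr [LHS]mxE.
rewrite [X in intW _ _ X]mxE intWD//.
by rewrite [RHS]mxE [X in _ = X + _]mxE [X in _ = _ + X]mxE.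
Qed.

Lemma gram_scalmxr (p m n : nat) (A : 'M[R]_(p, n)) (u : 'cV[bipoly R]_m)
    (v : 'cV[bipoly R]_n) : gram Om W u (A *pm v) = gram Om W u v *m A^T.
Proof.
apply: trmx_inj; refine (etrans (gram_tr _ _) _).
by rewrite gram_scalmxl trmx_mul trmxK (gram_tr u v).
Qed.

Lemma gramZlr (m n : nat) (c : bipoly R) (u : 'cV[bipoly R]_m) (v : 'cV[bipoly R]_n) :
  gram Om W (c *: u) v = gram Om W u (c *: v).
Proof. by rewrite /gram linearZ /= -scalemxAr -scalemxAl. Qed.

Variable SS : polysys R.
Hypothesis hS : is_mops Om W SS.

Lemma mcoeff_mops (n : nat) (j : 'I_n.+1) (m : multinom 2) :
  (n <= mdeg m)%N -> mcoeff m (SS n j 0) = (mon (n - j) j == m)%:R.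
Proof.
move=> le; have [/(_ n j) + _] := hS.
move=> /msizeP /(_ m le) /eqP; rewrite mcoeffB subr_eq0 => /eqP ->.
by rewrite XxXyE mcoeffX.
Qed.

Lemma msize_mops (n : nat) (j : 'I_n.+1) : (msize (SS n j 0)%R <= n.+1)%N.
Proof.
apply/msizeP => m le; rewrite mcoeff_mops ?(ltnW le)//.
case: eqP => // e; move: le; rewrite -e mdeg_mon subnK ?ltnn//.
by rewrite -ltnS.
Qed.

(** * Orthogonality to lower degrees and invertible Gram matrices *)

(** Induction on the degree: a monomial of degree d is an entry of S_d minus a polynomial of lower
    degree. With [r] arbitrary, this serves both the entries of S_n and the remainder of the three
    term relation. *)
Lemma orth_low (r : bipoly R) (n : nat) :
  (forall m (j : 'I_m.+1), (m < n)%N -> intW Om W (r * SS m j 0) = 0) ->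
  forall p : bipoly R, (msize p <= n)%N -> intW Om W (r * p) = 0.
Proof.
elim: n => [|n IH] h p lep.
  by move: lep; rewrite leqn0 msize_poly_eq0 => /eqP ->; rewrite mulr0 intW0.
rewrite [p]mpolyE mulr_sumr intW_sum big_seq big1// => m mp.
rewrite -scalerAr intWZ// (_ : intW _ _ _ = 0) ?mulr0//.
have ltm : (mdeg m < n.+1)%N := leq_trans (msize_mdeg_lt mp) lep.
have mE : mdeg m = (m (0%R : 'I_2) + m (1%R : 'I_2))%N.
  by rewrite -[in LHS](mon_eta m) mdeg_mon.
(* The entry of S_d with leading monomial m is the one indexed by the exponent of y. *)
have lt1 : (m (1%R : 'I_2) < (mdeg m).+1)%N by rewrite mE ltnS leq_addl.
have [/(_ _ (Ordinal lt1)) le _] := hS.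
rewrite -[mpolyX R m](subKr (SS (mdeg m) (Ordinal lt1) 0)).
rewrite mulrBr -scaleN1r intWD// intWZ// h// add0r.
rewrite IH ?mulr0//; first by move=> m' j' lt'; apply: h; exact: ltnW.
apply: leq_trans (_ : mdeg m <= n)%N => //.
have eX : (mdeg m - m (1%R : 'I_2) = m (0%R : 'I_2))%N by rewrite mE addnK.
by move: le; rewrite XxXyE /= eX mon_eta.
Qed.

Lemma orth_mops (n : nat) (i : 'I_n.+1) (p : bipoly R) :
  (msize p <= n)%N -> intW Om W (SS n i 0 * p) = 0.
Proof.
apply: orth_low => m j lt; have nm : n <> m by move=> e; rewrite e ltnn in lt.
by have [_ /(_ n m nm) /matrixP/(_ i j)] := hS; rewrite gramE mxE.
Qed.

(** A row u in the left kernel gives a combination u S_n of zero square integral, hence zero by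
    definiteness; the leading monomials are distinct, so u = 0. *)
Lemma gram_mops_unit (n : nat) : gram Om W (SS n) (SS n) \in unitmx.
Proof.
rewrite -row_free_unit -kermx_eq0; apply/rowV0P => u /sub_kermxP uH.
have : gram Om W (u *pm SS n) (u *pm SS n) = 0.
  by rewrite gram_scalmxl gram_scalmxr mulmxA uH mul0mx.
move=> /matrixP/(_ 0 0); rewrite gramE [RHS]mxE => /(intW_sqr_eq0 hW).
rewrite scalmxE => u0; apply/rowP => j; rewrite mxE.
have /(congr1 (mcoeff (mon (n - j) j))) := u0.
have lej : (j <= n)%N by rewrite -ltnS.
rewrite mcoeff0 raddf_sum /= (bigD1 j)//= mcoeffZ mcoeff_mops; last first.
  by rewrite mdeg_mon subnK.
rewrite eqxx mulr1 big1 ?addr0// => l ne.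
rewrite mcoeffZ mcoeff_mops; last by rewrite mdeg_mon subnK.
by rewrite mon_inj andbC val_eqE (negbTE ne) mulr0.
Qed.

(** Row i of L_{n,k} selects the entry of S_{n+1} whose leading monomial is x_k times that of
    S_{n,i}, so the terms of degree n + 1 cancel. *)
Lemma msize_lead (k n : nat) (i : 'I_n.+1) : k = 1%N \/ k = 2%N ->
  (msize ((xvar R k *: SS n - Lmx R k n.+1 *pm SS n.+1) i 0)%R <= n.+1)%N.
Proof.
move=> hk; have lei : (i <= n)%N by rewrite -ltnS.
have lti : (i + (k - 1) < n.+2)%N by case: hk => ->; lia.
rewrite [X in msize X]mxE [X in msize (X + _)]mxE [X in msize (_ + X)]mxE.
rewrite (@Lmx_scalE _ _ _ _ _ (Ordinal lti))//.
set p := SS n i 0; set q := SS n.+1 _ 0.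
rewrite (_ : _ - _ = xvar R k * (p - mpolyX R (mon (n - i) i))
  - (q - mpolyX R (mon (n.+1 - (i + (k - 1))) (i + (k - 1))))); last first.
  by rewrite mulrBr xvar_mon// opprB addrC addrA subrK addrC.
apply: leq_trans (msizeD_le _ _) _; rewrite geq_max msizeN; apply/andP; split.
  by apply: msize_xvarM; have [/(_ n i)] := hS; rewrite XxXyE.
by have [/(_ n.+1 (Ordinal lti))] := hS; rewrite XxXyE.
Qed.

Variable Ph : nat -> nat -> polysys R.
Hypothesis hP : small_systems SS Ph.

Lemma small_systems_parity (n : nat) (i : 'I_n.+1) (m : multinom 2) :
  odd (mdeg m) != odd n -> mcoeff m (SS n i 0) = 0.
Proof.
(* Write n as a parity bit plus a double, so that [hP n./2] applies; the type of [i] depends on n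
   and is rewritten along. *)
have := odd_double_half n; case: (odd n) => /= e; move: i; rewrite -{}e odd_mdeg => i.
  have [_ ->] := hP n./2.
  move: (_ *pm _) (_ *pm _) => v u; rewrite !mxE mcoeffD.
  have := mcoeff_sq true false (u i 0) m; rewrite expr1 expr0 mulr1 => ->.
  have := mcoeff_sq false true (v i 0) m; rewrite expr1 expr0 mul1r => ->.
  by case: odd; case: odd => //=; rewrite addr0.
have [-> _] := hP n./2.
move: (_ *pm _) (_ *pm _) => v u; rewrite !mxE mcoeffD.
have := mcoeff_sq false false (u i 0) m; rewrite expr0 !mul1r => ->.
have := mcoeff_sq true true (v i 0) m; rewrite !expr1 => ->.
by case: odd; case: odd => //=; rewrite addr0.
Qed.

(** In degree exactly n both x_k S_n and S_{n+1} vanish by parity, which improves [msize_lead] by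
    one degree. *)
Lemma msize_three_term (k n : nat) (i : 'I_n.+1) : k = 1%N \/ k = 2%N ->
  (msize ((xvar R k *: SS n - Lmx R k n.+1 *pm SS n.+1) i 0)%R <= n)%N.
Proof.
move=> hk; apply/msizeP => m; rewrite leq_eqVlt => /orP[/eqP en|lt]; last first.
  by move/msizeP: (msize_lead i hk) => /(_ _ lt).
have lti : (i + (k - 1) < n.+2)%N by have := ltn_ord i; case: hk => ->; lia.
rewrite [X in mcoeff _ X]mxE [X in mcoeff _ (X + _)]mxE [X in mcoeff _ (_ + X)]mxE.
rewrite (@Lmx_scalE _ _ _ _ _ (Ordinal lti))// mcoeffB.
rewrite (@mcoeff_xvarM_eq0 _ _ _ (odd n)) ?small_systems_parity ?subr0 -?en//=.
  by case: odd.
by move=> m' ?; rewrite small_systems_parity// en.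
Qed.

(** The remainder [r] has degree below n and is orthogonal to every S_m with m < n, hence entrywise
    to itself; definiteness makes it zero. *)
Lemma three_term (k n : nat) : k = 1%N \/ k = 2%N ->
  xvar R k *: SS n
  = Lmx R k n.+1 *pm SS n.+1 + Gam Om W SS n k *pm pred_vec SS n.
Proof.
move=> hk; apply/eqP; rewrite -subr_eq0 opprD addrA; apply/eqP.
set q := xvar R k *: SS n - _.
set r := q - _.
(* Moving x_k to the other factor turns x_k S_m into L_{m,k} S_{m+1} plus a vector of degree at most
   m < n, which is orthogonal to S_n. *)
have gq m : (m < n)%N ->
    gram Om W q (SS m) = gram Om W (SS n) (SS m.+1) *m (Lmx R k m.+1)^T.
  move=> lt; rewrite gramBl gram_scalmxl (_ : gram _ _ (SS n.+1) _ = 0); last first.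
    by have [_ ->] := hS => //; lia.
  rewrite mulmx0 subr0 gramZlr -[xvar R k *: SS m](subrK (Lmx R k m.+1 *pm SS m.+1)).
  rewrite gramDr gram_scalmxr -[RHS]add0r; congr (_ + _).
  apply/matrixP => i j; rewrite gramE [RHS]mxE.
  by apply: orth_mops; apply: leq_trans (msize_lead j hk) lt.
have gr m : (m < n)%N -> gram Om W r (SS m) = 0.
  move=> lt; rewrite gramBl gq// gram_scalmxl /Gam.
  (* For m just below the original n, the inverse in Gamma cancels the Gram matrix; for smaller m
     both terms vanish by orthogonality. *)
  case: n @q @r gq lt => // n q r _; rewrite ltnS leq_eqVlt => /orP[/eqP ->|lt] /=.
    by rewrite mulmxKV ?gram_mops_unit// subrr.
  have [_ o] := hS; have nm : n <> m by move=> e; rewrite e ltnn in lt.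
  by rewrite (o n.+1 m.+1) => [|[]//]; rewrite (o n m nm) mul0mx mulmx0 subr0.
apply/colP => i; rewrite [RHS]mxE; apply: (intW_sqr_eq0 hW).
apply: (@orth_low _ n) => [m j lt|].
  by have /matrixP/(_ i j) := gr m lt; rewrite gramE [RHS]mxE.
rewrite [X in msize X]mxE; apply: leq_trans (msizeD_le _ _) _.
rewrite geq_max msize_three_term//= [X in msize X]mxE msizeN.
(* For n = 0 the correction is an empty sum, of size 0. *)
case: n @q @r gq gr i => [|n] q r _ _ i /=.
  by rewrite scalmxE big_ord0 msize0.
rewrite scalmxE; apply: leq_trans (msize_sum _ _ _) _; apply/bigmax_leqP => l _.
exact: leq_trans (msizeZ_le _ _) (msize_mops l).
Qed.
End Moments.

(** * Extraction of the small systems *)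

Lemma Jmx_mulE (R : realType) (j r c p : nat) (M : 'M[R]_(c, p)) (h : 'I_r)
    (l : 'I_c) (i : 'I_p) : l = (h.*2 + j)%N :> nat -> (Jmx R j r c *m M) h i = M l i.
Proof.
move=> e; rewrite mxE (bigD1 l)//= mxE e eqxx mul1r big1 ?addr0// => l' ne.
by rewrite mxE -e val_eqE (negbTE ne) mul0r.
Qed.

Lemma mul_JmxTE (R : realType) (j r c p : nat) (M : 'M[R]_(p, c)) (h : 'I_r)
    (l : 'I_c) (i : 'I_p) :
  l = (h.*2 + j)%N :> nat -> (M *m (Jmx R j r c)^T) i h = M i l.
Proof. by move=> e; rewrite -[M]trmxK -trmx_mul mxE (Jmx_mulE _ _ e) !mxE. Qed.

Lemma double_ord_lt (n j c : nat) (h : 'I_n) :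
  (n.*2 + j <= c.+1)%N -> (h.*2 + j < c)%N.
Proof. by have := ltn_ord h; lia. Qed.

Lemma Jmx_mulT (R : realType) (j j' r r' c : nat) :
  (forall h : 'I_r, h.*2 + j < c)%N ->
  Jmx R j r c *m (Jmx R j' r' c)^T = \matrix_(h, h') (h.*2 + j == h'.*2 + j')%N%:R.
Proof.
move=> lt; apply/matrixP => h h'.
by rewrite (@Jmx_mulE _ _ _ _ _ _ _ (Ordinal (lt h))) // !mxE.
Qed.

(** The product samples L_{n,k} at rows 2h + j and columns 2h' + j'. In the four relations this is
    either the identity or a smaller L. *)
Lemma Jmx_Lmx_mulT (R : realType) (k j j' r r' c : nat) :
  (forall h : 'I_r, h.*2 + j < c)%N -> (forall h : 'I_r', h.*2 + j' < c.+1)%N ->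
  Jmx R j r c *m Lmx R k c *m (Jmx R j' r' c.+1)^T
  = \matrix_(h, h') (h'.*2 + j' == h.*2 + j + (k - 1))%N%:R.
Proof.
move=> lt lt'; apply/matrixP => h h'.
rewrite (@mul_JmxTE _ _ _ _ _ _ _ (Ordinal (lt' h')))//.
by rewrite (@Jmx_mulE _ _ _ _ _ _ _ (Ordinal (lt h))) // !mxE.
Qed.

(** Distinct rows have their 1 in distinct columns; thus J recovers the small vector from its image
    under the transpose of J. *)
Lemma Jmx_mulT1 (R : realType) (j r c : nat) :
  (forall h : 'I_r, h.*2 + j < c)%N -> Jmx R j r c *m (Jmx R j r c)^T = 1%:M.
Proof.
move=> lt; rewrite Jmx_mulT//; apply/matrixP => h h'; rewrite !mxE.
by rewrite eqn_add2r -!muln2 eqn_pmul2r.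
Qed.

(** The two matrices have their 1s in columns of opposite parities. *)
Lemma Jmx_mulT0 (R : realType) (j j' r r' c : nat) : odd (j + j') ->
  (forall h : 'I_r, h.*2 + j < c)%N -> Jmx R j r c *m (Jmx R j' r' c)^T = 0.
Proof.
move=> o lt; rewrite Jmx_mulT//; apply/matrixP => h h'; rewrite !mxE.
by case: eqP => // e; have := congr1 odd e; move: o; rewrite !oddD !odd_double; lia.
Qed.

Lemma atsqD (R : realType) (n : nat) (u v : 'cV[bipoly R]_n) :
  atsq (u + v) = atsq u + atsq v.
Proof. exact: map_mxD. Qed.

Lemma atsq0 (R : realType) (n : nat) : atsq (0 : 'cV[bipoly R]_n) = 0.
Proof. exact: map_mx0. Qed.

Lemma atsq_xvar (R : realType) (n k : nat) (u : 'cV[bipoly R]_n) :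
  atsq (xvar R k *: u) = (xvar R k * xvar R k) *: atsq u.
Proof.
apply/colP => i; rewrite /atsq; rewrite !mxE rmorphM /=; congr (_ * _).
by rewrite /xvar; case: ifP => _; rewrite /Xx /Xy comp_mpolyXU /= expr2.
Qed.

(** * Comparison within one parity class *)

(** Expresses that [c] and [c'] head disjoint parity classes, so the [c] components can be compared
    alone. *)
Definition separates (R : realType) (c c' : bipoly R) : Prop :=
  forall (n : nat) (a b e : 'cV[bipoly R]_n),
  c *: atsq a = c *: atsq b + c' *: atsq e -> a = b.

Lemma separates_mon (R : realType) (i j i' j' : bool) : (i, j) != (i', j') ->
  separates (Xx R ^+ i * Xy R ^+ j) (Xx R ^+ i' * Xy R ^+ j').
Proof.
move=> ne n a b e E; apply/colP => l; apply/mpolyP => m.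
(* The monomial of class (i, j) that corresponds to m after halving; the other class does not
   contain it. *)
pose m' := mon (i + (m (0 : 'I_2)).*2) (j + (m (1 : 'I_2)).*2).
have := congr1 (fun v : 'cV[bipoly R]_n => mcoeff m' (v l 0)) E.
rewrite !mxE mcoeffD !mcoeff_sq !mon0 !mon1 !oddD !odd_double !addbF !oddb !eqxx /=.
rewrite (_ : _ && _ = false) ?addr0; last first.
  by move: ne; case: i i' j j' {E m'} => -[] [] [].
by rewrite !half_bit_double mon_eta.
Qed.

(** The index 3 - k is that of the other variable, so both values of k are treated at once. *)
Lemma separates_xvar (R : realType) (k : nat) : k = 1%N \/ k = 2%N ->
  [/\ separates (xvar R k) (xvar R (3 - k)), separates (xvar R (3 - k)) (xvar R k),
      separates 1 (xvar R k * xvar R (3 - k))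
    & separates (xvar R k * xvar R (3 - k)) 1].
Proof.
have := (@separates_mon R true false false true isT,
         @separates_mon R false true true false isT,
         @separates_mon R false false true true isT,
         @separates_mon R true true false false isT).
rewrite !expr1 !expr0 !mul1r !mulr1 => -[[[s1 s2] s3] s4].
case=> ->; first by split; [exact: s1|exact: s2|exact: s3|exact: s4].
have -> : xvar R 2 * xvar R (3 - 2) = Xx R * Xy R by rewrite mulrC.
by split; [exact: s2|exact: s1|exact: s3|exact: s4].
Qed.

Lemma scalmx_atsq_add (R : realType) (m n p q : nat) (A : 'M[R]_(m, n))
    (c c' : bipoly R) (B : 'M[R]_(n, p)) (B' : 'M[R]_(n, q)) u v :
  A *pm (c *: atsq (B *pm u) + c' *: atsq (B' *pm v))
  = c *: atsq ((A *m B) *pm u) + c' *: atsq ((A *m B') *pm v).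
Proof. by rewrite scalmxDr !scalmxZr !scalmx_atsq !scalmxA. Qed.

(** Common pattern of the four relations: U is x_k S_m, V and V' are S_{m+1} and S_{m-1}, and A is
    the J that selects the rows where U lies in the class of [c]. *)
Lemma extract_class (R : realType) (r n1 n2 n3 p p' q q' : nat) (c c' : bipoly R)
    (A : 'M[R]_(r, n1)) (M : 'M[R]_(n1, n2)) (G : 'M[R]_(n1, n3)) U V V'
    (B : 'M[R]_(n2, p)) (B' : 'M[R]_(n2, p')) (C : 'M[R]_(n3, q)) (C' : 'M[R]_(n3, q'))
    a v v' w w' :
  separates c c' -> U = M *pm V + G *pm V' -> A *pm U = c *: atsq a ->
  V = c *: atsq (B *pm v) + c' *: atsq (B' *pm v') ->
  V' = c *: atsq (C *pm w) + c' *: atsq (C' *pm w') ->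
  a = (A *m M *m B) *pm v + (A *m G *m C) *pm w.
Proof.
move=> s UE + VE V'E; rewrite UE VE V'E scalmxDr !scalmxA !scalmx_atsq_add.
by rewrite addrACA -!scalerDr -!atsqD => /esym /s.
Qed.

Section SmallSystems.
Variables (R : realType) (SS : polysys R) (Ph : nat -> nat -> polysys R).
Hypothesis hP : small_systems SS Ph.
Variable k : nat.
Hypothesis hk : k = 1%N \/ k = 2%N.

Lemma SS_even (n : nat) :
  SS n.*2 = 1 *: atsq ((Jmx R 0 n.+1 n.*2.+1)^T *pm Ph 0%N 0%N n)
  + (xvar R k * xvar R (3 - k)) *:
      atsq ((Jmx R 1 n n.*2.+1)^T *pm pred_vec (Ph 1%N 1%N) n).
Proof.
have [-> _] := hP n; rewrite scale1r; congr (_ + _ *: _).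
by case: hk => -> //=; rewrite mulrC.
Qed.

Lemma SS_odd (n : nat) :
  SS n.*2.+1
  = xvar R k *: atsq ((Jmx R (k - 1) n.+1 n.*2.+2)^T *pm Ph (2 - k)%N (k - 1)%N n)
  + xvar R (3 - k) *:
      atsq ((Jmx R (2 - k) n.+1 n.*2.+2)^T *pm Ph (k - 1)%N (2 - k)%N n).
Proof. by have [_ ->] := hP n; case: hk => ->; [|rewrite [RHS]addrC]. Qed.

Lemma pred_SS_even (n : nat) :
  pred_vec SS n.*2
  = xvar R k *: atsq ((Jmx R (k - 1) n n.*2)^T *pm pred_vec (Ph (2 - k)%N (k - 1)%N) n)
  + xvar R (3 - k) *:
      atsq ((Jmx R (2 - k) n n.*2)^T *pm pred_vec (Ph (k - 1)%N (2 - k)%N) n).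
(* For n = 0 both sides are empty; otherwise the predecessor of 2n is an odd index. *)
Proof. by case: n => [|n]; [apply/colP => -[]|exact: SS_odd]. Qed.

Lemma J0_SS_even (n : nat) : Jmx R 0 n.+1 n.*2.+1 *pm SS n.*2 = 1 *: atsq (Ph 0%N 0%N n).
Proof.
have lt (h : 'I_n.+1) : (h.*2 + 0 < n.*2.+1)%N by apply: double_ord_lt; lia.
rewrite SS_even scalmx_atsq_add Jmx_mulT1 // Jmx_mulT0 //.
by rewrite scal1mx scal0mx atsq0 scaler0 addr0.
Qed.

Lemma J1_SS_even (n : nat) : Jmx R 1 n n.*2.+1 *pm SS n.*2
  = (xvar R k * xvar R (3 - k)) *: atsq (pred_vec (Ph 1%N 1%N) n).
Proof.
have lt (h : 'I_n) : (h.*2 + 1 < n.*2.+1)%N by apply: double_ord_lt; lia.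
rewrite SS_even scalmx_atsq_add Jmx_mulT0 // Jmx_mulT1 //.
by rewrite scal1mx scal0mx atsq0 scaler0 add0r.
Qed.

Lemma J0_SS_odd (n : nat) : Jmx R (k - 1) n.+1 n.*2.+2 *pm SS n.*2.+1
  = xvar R k *: atsq (Ph (2 - k)%N (k - 1)%N n).
Proof.
have o : odd (k - 1 + (2 - k)) by case: hk => ->.
have lt (h : 'I_n.+1) : (h.*2 + (k - 1) < n.*2.+2)%N.
  by apply: double_ord_lt; case: hk => ->; lia.
rewrite SS_odd scalmx_atsq_add Jmx_mulT1 // Jmx_mulT0 //.
by rewrite scal1mx scal0mx atsq0 scaler0 addr0.
Qed.

Lemma J1_SS_odd (n : nat) : Jmx R (2 - k) n.+1 n.*2.+2 *pm SS n.*2.+1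
  = xvar R (3 - k) *: atsq (Ph (k - 1)%N (2 - k)%N n).
Proof.
have o : odd (2 - k + (k - 1)) by case: hk => ->.
have lt (h : 'I_n.+1) : (h.*2 + (2 - k) < n.*2.+2)%N.
  by apply: double_ord_lt; case: hk => ->; lia.
rewrite SS_odd scalmx_atsq_add Jmx_mulT0 // Jmx_mulT1 //.
by rewrite scal1mx scal0mx atsq0 scaler0 add0r.
Qed.
End SmallSystems.

Theorem corollary5p7 (R : realType) (Om : set (plane R)) (W : plane R -> R)
    (SS : polysys R) (Ph : nat -> nat -> polysys R)
    (hW : weight_function Om W) (hsym : xy_symmetric Om W)
    (hS : is_mops Om W SS) (hP : small_systems SS Ph)
    (k : nat) (hk : k = 1%N \/ k = 2%N) :
  [/\ forall n : nat,
        Ph 0%N 0%N n = Ph (2 - k)%N (k - 1)%N n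
                   + hGam00 Om W SS n k *pm pred_vec (Ph (2 - k)%N (k - 1)%N) n,
      forall n : nat, (1 <= n)%N ->
        xvar R k *: pred_vec (Ph 1%N 1%N) n
        = Lmx R k n *pm Ph (k - 1)%N (2 - k)%N n
          + hGam01 Om W SS n k *pm pred_vec (Ph (k - 1)%N (2 - k)%N) n,
      forall n : nat,
        Ph (k - 1)%N (2 - k)%N n
        = Ph 1%N 1%N n + hGam11 Om W SS n k *pm pred_vec (Ph 1%N 1%N) n
    & forall n : nat,
        xvar R k *: Ph (2 - k)%N (k - 1)%N n
        = Lmx R k n.+1 *pm Ph 0%N 0%N n.+1 + hGam10 Om W SS n k *pm Ph 0%N 0%N n].
Proof.
have [s1 s2 s3 s4] := separates_xvar R hk.
have T n := three_term hW hS hP n hk.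
have lt0 n (h : 'I_n.+1) : (h.*2 + 0 < n.*2.+1)%N by apply: double_ord_lt; lia.
have lt1 n (h : 'I_n) : (h.*2 + 1 < n.*2.+1)%N by apply: double_ord_lt; lia.
have ltk n (h : 'I_n.+1) : (h.*2 + (k - 1) < n.*2.+2)%N.
  by apply: double_ord_lt; case: hk => ->; lia.
have ltk' n (h : 'I_n.+1) : (h.*2 + (2 - k) < n.*2.+2)%N.
  by apply: double_ord_lt; case: hk => ->; lia.
split=> n.
- have A : Jmx R 0 n.+1 n.*2.+1 *pm (xvar R k *: SS n.*2)
      = xvar R k *: atsq (Ph 0%N 0%N n).
    by rewrite scalmxZr (J0_SS_even hP hk) scale1r.
  refine (etrans (extract_class s1 (T n.*2) A (SS_odd hP hk n) (pred_SS_even hP hk n)) _).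
  (* The second coefficient is the hatted Gamma by definition, so only J L J^T remains; both index
     shifts are k - 1 and it is the identity. *)
  rewrite Jmx_Lmx_mulT; [|exact: lt0|exact: ltk]; apply: f_equal2; last by [].
  rewrite (_ : \matrix_(_, _) _ = 1%:M) ?scal1mx//.
  by apply/matrixP => h h'; rewrite !mxE eqn_add2r addn0 -!muln2 eqn_pmul2r// eq_sym.
(* Here x_k (x_k x_{3-k}) = x_{3-k} x_k^2: the class is that of x_{3-k}, and x_k^2 becomes the
   factor x_k before substitution. *)
- move=> _; have A : Jmx R 1 n n.*2.+1 *pm (xvar R k *: SS n.*2)
      = xvar R (3 - k) *: atsq (xvar R k *: pred_vec (Ph 1%N 1%N) n).
    rewrite scalmxZr (J1_SS_even hP hk) atsq_xvar !scalerA.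
    by congr (_ *: _); rewrite mulrA mulrC.
  have V := SS_odd hP hk n; have V' := pred_SS_even hP hk n.
  (* The surviving class has to come first. *)
  rewrite [RHS]addrC in V; rewrite [RHS]addrC in V'.
  refine (etrans (extract_class s2 (T n.*2) A V V') _).
  rewrite Jmx_Lmx_mulT; [|exact: lt1|exact: ltk']; apply: f_equal2; last by [].
  congr (_ *pm _).
  apply/matrixP => h h'; rewrite !mxE; congr (nat_of_bool _)%:R.
  (* The condition 2h' + 2 - k = 2h + 1 + (k - 1) amounts to h' = h + (k - 1), the pattern of L. *)
  by case: hk => ->; apply/eqP/eqP; lia.
- have A : Jmx R (2 - k) n.+1 n.*2.+2 *pm (xvar R k *: SS n.*2.+1)
      = (xvar R k * xvar R (3 - k)) *: atsq (Ph (k - 1)%N (2 - k)%N n).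
    by rewrite scalmxZr (J1_SS_odd hP hk) scalerA.
  have V := SS_even hP hk n.+1; have V' := SS_even hP hk n.
  rewrite [RHS]addrC in V; rewrite [RHS]addrC in V'.
  refine (etrans (extract_class s4 (T n.*2.+1) A V V') _).
  rewrite Jmx_Lmx_mulT; [|exact: ltk'|exact: (lt1 n.+1)]; apply: f_equal2; last by [].
  (* Since (2 - k) + (k - 1) = 1, the columns match exactly when h' = h. *)
  rewrite (_ : \matrix_(_, _) _ = 1%:M) ?scal1mx//.
  apply/matrixP => h h'; rewrite !mxE; congr (nat_of_bool _)%:R.
  by rewrite -val_eqE; case: hk => ->; apply/eqP/eqP => /=; lia.
(* Now x_k times x_k is a square, so the class is that of 1. *)
- have A : Jmx R (k - 1) n.+1 n.*2.+2 *pm (xvar R k *: SS n.*2.+1)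
      = 1 *: atsq (xvar R k *: Ph (2 - k)%N (k - 1)%N n).
    by rewrite scalmxZr (J0_SS_odd hP hk) atsq_xvar scalerA scale1r.
  refine (etrans (extract_class s3 (T n.*2.+1) A (SS_even hP hk n.+1) (SS_even hP hk n)) _).
  rewrite Jmx_Lmx_mulT; [|exact: ltk|exact: (lt0 n.+1)]; apply: f_equal2; last by [].
  congr (_ *pm _).
  apply/matrixP => h h'; rewrite !mxE; congr (nat_of_bool _)%:R.
  by case: hk => ->; apply/eqP/eqP; lia.
Qed.
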